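(* Let $\boldsymbol{A}\in\mathcal{DM}_{\rm loc}(\Omega)$, let $\lambda:\Omega\to[0,1]$ be a Borel function and let $E\subset\Omega$ be a Borel set. Then $$\operatorname{supp}\big((\boldsymbol{A},D\chi_E)_\lambda\big)\subseteq\partial^-E.$$
   Context: $\Omega\subset\mathbb{R}^N$ is a nonempty open set; $\mathscr{L}^N$ is Lebesgue measure; $\mathcal{M}_{\rm loc}(\Omega)$, $\mathcal{M}_{\rm loc}(\Omega;\mathbb{R}^N)$ are the spaces of locally finite real, respectively $\mathbb{R}^N$-valued, Radon measures on $\Omega$. $\mathcal{DM}_{\rm loc}(\Omega)$ is the set of $\boldsymbol{A}\in\mathcal{M}_{\rm loc}(\Omega;\mathbb{R}^N)$ with distributional divergence $\mathrm{div}\boldsymbol{A}\in\mathcal{M}_{\rm loc}(\Omega)$. For a Borel set $E$: $E^1$ is the set of points where $E$ has Lebesgue density $1$, $\partial^*E:=\mathbb{R}^N\setminus(E^1\cup(\mathbb{R}^N\setminus E)^1)$, and $$\partial^-E:=\{x\in\mathbb{R}^N:0<\mathscr{L}^N(E\cap B_r(x))<\mathscr{L}^N(B_r(x))\ \text{for all }r>0\}.$$ The $\lambda$-representative of $\chi_E$ is $\chi_E^\lambda=\chi_{E^1}+\lambda\chi_{\partial^*E}$, and the $\lambda$-pairing is the distribution on $\Omega$ $$\langle(\boldsymbol{A},D\chi_E)_\lambda,\varphi\rangle:=-\int_\Omega\chi_E^\lambda\varphi\,d\,\mathrm{div}\boldsymbol{A}-\int_\Omega\chi_E^\lambda\nabla\varphi\cdot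 d\boldsymbol{A},\qquad\varphi\in C_c^\infty(\Omega).$$ The support of a distribution on $\Omega$ is the complement in $\Omega$ of the union of the open sets $U\subset\Omega$ such that the distribution vanishes on all test functions with compact support in $U$. *)

(* Defs.v *)
From HB Require Import structures.
From mathcomp Require Import all_boot all_order all_algebra.
From mathcomp Require Import all_classical all_reals all_analysis.
From mathcomp Require Import measurable_realfun.

Set Implicit Arguments.
Unset Strict Implicit.
Unset Printing Implicit Defensive.

Import Order.TTheory GRing.Theory Num.Theory.
Import numFieldNormedType.Exports.

Local Open Scope classical_set_scope.
Local Open Scope ring_scope.

(* The sigma-algebra put on 'rV[R]_N is the Borel one. *)
HB.instance Definition _ (R : realType) (N : nat) :=
  @isMeasurable.Build (sigma_display (@open 'rV[R]_N)) 'rV[R]_N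
    <<s @open 'rV[R]_N >>
    (@sigma_algebra0 _ _ _) (@sigma_algebraC _ _) (@sigma_algebra_bigcup _ _ _).

Section lebesgue_tuple.
Context {R : realType}.
Local Notation leb := (@lebesgue_measure R).
Local Notation mR := (measurableTypeR R).

Definition tuple_of_pair n (p : mR * n.-tuple mR) : n.+1.-tuple mR :=
  [tuple of p.1 :: p.2].

Definition pair_of_tuple n (t : n.+1.-tuple mR) : mR * n.-tuple mR :=
  (thead t, [tuple of behead t]).

Lemma measurable_tuple_of_pair n : measurable_fun setT (@tuple_of_pair n).
Proof. exact: measurable_cons. Qed.

Lemma measurable_pair_of_tuple n : measurable_fun setT (@pair_of_tuple n).
Proof.
apply: measurable_fun_pair; last exact: measurable_behead.
exact: measurable_tnth.
Qed.

Lemma tuple_of_pairK n : cancel (@tuple_of_pair n) (@pair_of_tuple n).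
Proof.
by case=> x t; rewrite /pair_of_tuple theadE; congr pair; apply: val_inj.
Qed.

Lemma pair_of_tupleK n : cancel (@pair_of_tuple n) (@tuple_of_pair n).
Proof. by move=> t; rewrite [RHS]tuple_eta. Qed.

Section lebesgue_cons.
Context {n : nat}.
Variable m : {sigma_finite_measure set (n.-tuple mR) -> \bar R}.

Definition lebesgue_cons : set (n.+1.-tuple mR) -> \bar R :=
  pushforward (leb \x m)%E (@tuple_of_pair n).

Let mpre A : measurable A -> measurable (@tuple_of_pair n @^-1` A).
Proof.
by move=> mA; rewrite -[X in measurable X]setTI; exact: measurable_tuple_of_pair.
Qed.

Let lebesgue_cons0 : lebesgue_cons set0 = 0%E.
Proof. by rewrite /lebesgue_cons /pushforward preimage_set0 measure0. Qed.

Let lebesgue_cons_ge0 A : (0 <= lebesgue_cons A)%E.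
Proof. by rewrite /lebesgue_cons /pushforward; exact: measure_ge0. Qed.

Let lebesgue_cons_sigma_additive : semi_sigma_additive lebesgue_cons.
Proof.
move=> F mF tF mUF; rewrite /lebesgue_cons /pushforward preimage_bigcup.
apply: measure_semi_sigma_additive.
- by move=> k; exact: mpre.
- apply/trivIsetP => /= i j _ _ ij; rewrite -preimage_setI.
  by move/trivIsetP : tF => /(_ _ _ _ _ ij) ->//; rewrite preimage_set0.
- by rewrite -preimage_bigcup; exact: mpre.
Qed.

HB.instance Definition _ := isMeasure.Build _ _ _ lebesgue_cons
  lebesgue_cons0 lebesgue_cons_ge0 lebesgue_cons_sigma_additive.

Let lebesgue_cons_sigma_finite : sigma_finite setT lebesgue_cons.
Proof.
have /sigma_finiteP[F [TF ndF Foo]] := sigma_finiteT leb.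
have /sigma_finiteP[G [TG ndG Goo]] := sigma_finiteT m.
exists (fun k => @pair_of_tuple n @^-1` (F k `*` G k)).
  rewrite -preimage_bigcup (_ : \bigcup_k _ = setT) ?preimage_setT//.
  rewrite -subTset -setXTT TF TG => -[x y] [/= [j _ Fjx] [k _ Gky]].
  exists (maxn j k) => //; split.
  - by move: x Fjx; exact/subsetPset/ndF/leq_maxl.
  - by move: y Gky; exact/subsetPset/ndG/leq_maxr.
move=> k; have [mF Fk] := Foo k; have [mG Gk] := Goo k; split.
  rewrite -[X in measurable X]setTI; apply: measurable_pair_of_tuple => //.
  exact: measurableX.
rewrite /lebesgue_cons /pushforward -comp_preimage.
rewrite (_ : _ \o _ = id); last by apply/funext => p; exact: tuple_of_pairK.
by rewrite preimage_id product_measure1E// lte_mul_pinfty// ge0_fin_numE.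
Qed.

HB.instance Definition _ := Measure_isSigmaFinite.Build _ _ _ lebesgue_cons
  lebesgue_cons_sigma_finite.

End lebesgue_cons.

Fixpoint lebesgue_tuple (n : nat) :
    {sigma_finite_measure set (n.-tuple mR) -> \bar R} :=
  match n with
  | 0 => \d_[tuple]
  | n'.+1 => lebesgue_cons (lebesgue_tuple n')
  end.

Lemma lebesgue_tuple_prod n (A : 'I_n -> set mR) :
  (forall i, measurable (A i)) ->
  (lebesgue_tuple n [set t | forall i, A i (tnth t i)]
   = \prod_(i < n) leb (A i))%E.
Proof.
elim: n A => [|n IH] A mA.
  rewrite big_ord0 /= diracE mem_set//.
  by move=> [].
rewrite big_ord_recl -IH//= -product_measure1E//; last first.
  rewrite (_ : mkset _ = \bigcap_(i in [set: 'I_n])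
      ((fun t : n.-tuple mR => tnth t i) @^-1` A (lift ord0 i))); last first.
    by apply/seteqP; split => [t /= tA i _|t /= tA i]; exact: tA.
  apply: fin_bigcap_measurable => // i _.
  by rewrite -[X in measurable X]setTI; exact: measurable_tnth.
rewrite /lebesgue_cons /pushforward; congr (_ _).
apply/seteqP; split => [[x t] /= tA|[x t] /= [Ax tA] i].
  by split; [have := tA ord0|move=> i; have := tA (lift ord0 i); rewrite tnthS].
by case: (unliftP ord0 i) => [j|] ->; rewrite ?tnthS.
Qed.

End lebesgue_tuple.

Section lebesgue_rV.
Context {R : realType} {N : nat}.
Local Notation mR := (measurableTypeR R).

Definition rV_of_tuple (t : N.-tuple mR) : 'rV[R]_N := \row_i tnth t i.

Lemma measurable_rV_of_tuple : measurable_fun setT rV_of_tuple.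
Proof.
apply: (@measurability _ _ _ _ _ _ (@open 'rV[R]_N)) => //.
move=> _ [U oU <-]; rewrite setTI.
pose B (p : 'rV[rat]_N * nat) : set 'rV[R]_N :=
  ball (map_mx ratr p.1 : 'rV[R]_N) p.2.+1%:R^-1.
have -> : U = \bigcup_p (if pselect (B p `<=` U) then B p else set0).
  apply/seteqP; split=> [x Ux|x [p _]]; last by case: pselect => // pU /pU.
  have /nbhs_ballP[e /= e0 eU] : nbhs x U by move: oU; rewrite openE; exact.
  have [k ke] : exists k : nat, (k.+1%:R^-1 : R) < e / 2.
    exists (Num.trunc (e / 2)^-1).
    by rewrite invf_plt ?posrE ?divr_gt0// truncnS_gt.
  have q i : exists q : rat, `|ratr q - x ord0 i| < k.+1%:R^-1.
    have [|q] := @rat_in_itvoo R (x ord0 i - k.+1%:R^-1) (x ord0 i + k.+1%:R^-1).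
      by rewrite ltrBlDr -addrA ltrDl addr_gt0 ?invr_gt0.
    by rewrite in_itv /= => q12; exists q; rewrite ltr_distl.
  have {q}[q xq] := choice q.
  have xB : B (\row_i q i, k) x.
    split=> [|i j]; first by rewrite /= invr_gt0.
    by rewrite !mxE ord1; exact: xq.
  exists (\row_i q i, k) => //.
  case: pselect => // -[] y yB; apply: eU.
  have /ball_sym xB' := xB.
  by apply: le_ball (ball_triangle xB' yB); rewrite (splitr e) lerD// ltW.
rewrite preimage_bigcup; apply: countable_bigcupT_measurable => [|p]; first exact: countableP.
case: pselect => pU; last by rewrite preimage_set0.
rewrite (_ : _ @^-1` _ = \bigcap_(i in [set: 'I_N])
  ((fun t : N.-tuple mR => tnth t i) @^-1` ball (ratr (p.1 ord0 i) : R) p.2.+1%:R^-1)).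
  apply: fin_bigcap_measurable => // i _.
  rewrite -[X in measurable X]setTI; apply: measurable_tnth => //.
  exact: measurable_ball.
apply/seteqP; split => t /=.
  by move=> [_ tB] i _; have := tB ord0 i; rewrite !mxE.
move=> tB; split; first by rewrite invr_gt0.
by move=> i j; rewrite !mxE ord1; exact: tB.
Qed.

(* The N-fold product of lebesgue_measure, seen on the Borel sets of 'rV[R]_N;
   see lebesgue_rV_prod. *)
Definition lebesgue_rV : set 'rV[R]_N -> \bar R :=
  pushforward (lebesgue_tuple N) rV_of_tuple.

Let mpre A : measurable A -> measurable (rV_of_tuple @^-1` A).
Proof.
by move=> mA; rewrite -[X in measurable X]setTI; exact: measurable_rV_of_tuple.
Qed.

Let lebesgue_rV0 : lebesgue_rV set0 = 0%E.
Proof. by rewrite /lebesgue_rV /pushforward preimage_set0 measure0. Qed.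

Let lebesgue_rV_ge0 A : (0 <= lebesgue_rV A)%E.
Proof. by rewrite /lebesgue_rV /pushforward; exact: measure_ge0. Qed.

Let lebesgue_rV_sigma_additive : semi_sigma_additive lebesgue_rV.
Proof.
move=> F mF tF mUF; rewrite /lebesgue_rV /pushforward preimage_bigcup.
apply: measure_semi_sigma_additive.
- by move=> k; exact: mpre.
- apply/trivIsetP => /= i j _ _ ij; rewrite -preimage_setI.
  by move/trivIsetP : tF => /(_ _ _ _ _ ij) ->//; rewrite preimage_set0.
- by rewrite -preimage_bigcup; exact: mpre.
Qed.

HB.instance Definition _ := isMeasure.Build _ _ _ lebesgue_rV
  lebesgue_rV0 lebesgue_rV_ge0 lebesgue_rV_sigma_additive.

Lemma lebesgue_rV_prod (A : 'I_N -> set mR) :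
  (forall i, measurable (A i)) ->
  (lebesgue_rV [set x | forall i, A i (x ord0 i)]
   = \prod_(i < N) @lebesgue_measure R (A i))%E.
Proof.
move=> mA; rewrite -lebesgue_tuple_prod// /lebesgue_rV /pushforward.
congr (lebesgue_tuple N _); apply/seteqP.
by split => t /= tA i; have := tA i; rewrite mxE.
Qed.

End lebesgue_rV.

Section charge_integral.
Context d (T : measurableType d) (R : realType).

(* The integral against a finite signed measure, through the Jordan
   decomposition; the Hahn decomposition chosen below is immaterial. *)
Definition charge_integral (nu : {charge set T -> \bar R}) (f : T -> R) : R :=
  let P := cid (Hahn_decomposition nu) in
  let nuPN := svalP (cid (svalP P)) in
  \int[jordan_pos nuPN]_x f x - \int[jordan_neg nuPN]_x f x.

End charge_integral.

Section radon.
Context {R : realType} {N : nat}.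
Local Notation RN := 'rV[R]_N.

Definition compact_in (Omega K : set RN) := compact K /\ K `<=` Omega.

(* A locally finite real Radon measure on Omega is a set function on the
   relatively compact Borel subsets of Omega whose restriction to every compact
   subset of Omega is a finite signed measure. The values of radon_fun on other
   sets are irrelevant. *)
Record radon (Omega : set RN) := Radon {
  radon_fun :> set RN -> R ;
  radon_fun0 : radon_fun set0 = 0 ;
  radon_fun_sigma_additive : forall K, compact_in Omega K ->
    semi_sigma_additive (fun A => (radon_fun (A `&` K))%:E) }.

Section radon_restr.
Context {Omega : set RN}.
Variables (mu : radon Omega) (K : set RN) (cK : compact_in Omega K).

(* The proof argument lets the charge instance be inferred. *)
Definition radon_restr of compact_in Omega K :=
  fun A : set RN => (mu (A `&` K))%:E.

Let radon_restr0 : radon_restr cK set0 = 0%E.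
Proof. by rewrite /radon_restr set0I radon_fun0. Qed.

Let radon_restr_fin A : measurable A -> radon_restr cK A \is a fin_num.
Proof. by []. Qed.

Let radon_restr_sigma_additive : semi_sigma_additive (radon_restr cK).
Proof. exact: radon_fun_sigma_additive. Qed.

HB.instance Definition _ := isCharge.Build _ _ _ (radon_restr cK)
  radon_restr0 radon_restr_fin radon_restr_sigma_additive.

(* For f vanishing outside K this is the integral of f over Omega. *)
Definition radon_integral (f : RN -> R) : R :=
  charge_integral (radon_restr cK) f.

End radon_restr.

(* An R^N-valued measure is given by its N components. *)
Definition vector_radon (Omega : set RN) := 'I_N -> radon Omega.

End radon.

Section test_function.
Context {R : realType} {N : nat}.
Local Notation RN := 'rV[R]_N.
Implicit Types (f : RN -> R) (Omega U : set RN).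

Definition partial (i : 'I_N) f : RN -> R := 'D_(delta_mx ord0 i) f.

Definition iter_partial (s : seq 'I_N) f : RN -> R := foldr partial f s.

Definition smooth f := forall s : seq 'I_N,
  continuous (iter_partial s f) /\
  forall i x, derivable (iter_partial s f) x (delta_mx ord0 i).

Definition tsupport f : set RN := closure [set x | f x != 0].

(* Elements of C_c^oo(Omega), extended by 0 to R^N. *)
Record test_function Omega := TestFunction {
  test_fun :> RN -> R ;
  test_fun_smooth : smooth test_fun ;
  test_fun_support : compact_in Omega (tsupport test_fun) }.

Definition dist_support Omega (u : test_function Omega -> R) : set RN :=
  Omega `\` \bigcup_(U in [set U | [/\ open U, U `<=` Omega &
    forall phi : test_function Omega, compact_in U (tsupport phi) ->
      u phi = 0]]) U.

End test_function.

Section divergence_measure.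
Context {R : realType} {N : nat}.
Local Notation RN := 'rV[R]_N.
Variable Omega : set RN.

(* \int_Omega g phi d mu *)
Definition weighted_integral (mu : radon Omega) (g : RN -> R)
    (phi : test_function Omega) : R :=
  radon_integral mu (test_fun_support phi) (fun x => g x * phi x).

(* \int_Omega g \nabla phi . d A *)
Definition weighted_flux (A : vector_radon Omega) (g : RN -> R)
    (phi : test_function Omega) : R :=
  \sum_(i < N) radon_integral (A i) (test_fun_support phi)
    (fun x => g x * partial i phi x).

Definition is_divergence (A : vector_radon Omega) (divA : radon Omega) :=
  forall phi : test_function Omega,
    weighted_integral divA (fun=> 1) phi = - weighted_flux A (fun=> 1) phi.

Record DMloc := DivMeasure {
  DM_field :> vector_radon Omega ;
  DM_div : radon Omega ;
  DM_divP : is_divergence DM_field DM_div }.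

End divergence_measure.

Section density.
Context {R : realType} {N : nat}.
Local Notation RN := 'rV[R]_N.
Implicit Types (x : RN) (E : set RN).

(* `|_| on 'rV[R]_N is the sup norm; B_r(x) is the Euclidean ball. *)
Definition eball x (r : R) : set RN :=
  [set y | Num.sqrt (\sum_(i < N) (y ord0 i - x ord0 i) ^+ 2) < r].

Definition density_one E : set RN :=
  [set x | fine (lebesgue_rV (E `&` eball x r)) / fine (lebesgue_rV (eball x r))
           @[r --> 0^'+] --> (1 : R)].

Definition ess_boundary E : set RN :=
  ~` (density_one E `|` density_one (~` E)).

Definition boundary_minus E : set RN :=
  [set x | forall r : R, 0 < r ->
    (0 < lebesgue_rV (E `&` eball x r) < lebesgue_rV (eball x r))%E].

Definition lambda_representative (lambda : RN -> R) E (x : RN) : R :=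
  \1_(density_one E) x + lambda x * \1_(ess_boundary E) x.

Definition lambda_pairing Omega (A : DMloc Omega) (lambda : RN -> R) E
    (phi : test_function Omega) : R :=
  - weighted_integral (DM_div A) (lambda_representative lambda E) phi
  - weighted_flux A (lambda_representative lambda E) phi.

End density.

(* Main.v *)
Require Import Defs.
From mathcomp Require Import all_boot all_order all_algebra.
From mathcomp Require Import all_classical all_reals all_analysis.
From mathcomp Require Import measurable_realfun.
Import Order.TTheory GRing.Theory Num.Theory.
Import numFieldNormedType.Exports.
Set Implicit Arguments.
Unset Strict Implicit.
Unset Printing Implicit Defensive.
Local Open Scope classical_set_scope.
Local Open Scope ring_scope.

(* If x in Omega is not in boundary_minus E, then E or its complement is
   Lebesgue-null in some ball around x. On that ball the lambda-representative
   of E is constantly 0, resp. 1, whatever lambda is: density is a local notion,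
   so no point of the ball belongs to the essential boundary. Tested on
   functions supported in the ball, the pairing is then 0, resp. the defining
   identity of the divergence, tested against phi. *)

Lemma open_measurable_rV (R : realType) (N : nat) (U : set 'rV[R]_N) :
  open U -> measurable U.
Proof. by move=> oU; apply: sub_sigma_algebra. Qed.

Lemma eball_open (R : realType) (N : nat) (x : 'rV[R]_N) (r : R) :
  open (eball x r).
Proof.
apply: (@open_comp _ _
  (fun y : 'rV[R]_N => Num.sqrt (\sum_(i < N) (y ord0 i - x ord0 i) ^+ 2))
  [set s | s < r]); last exact: open_lt.
move=> y _; apply: continuous_comp; last exact: sqrt_continuous.
move: y; apply: continuous_big => [|i _ y]; first exact: add_continuous.
apply: (@continuous_comp _ _ _ (fun z : 'rV[R]_N => z ord0 i - x ord0 i)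
  (fun s : R => s ^+ 2)); last exact: exprn_continuous.
by apply: continuousB; [exact: coord_continuous|exact: cst_continuous].
Qed.

Lemma eball_center (R : realType) (N : nat) (x : 'rV[R]_N) (r : R) :
  0 < r -> eball x r x.
Proof.
by move=> r0; rewrite /eball /= big1 ?sqrtr0// => i _; rewrite subrr expr0n.
Qed.

(** Each squared coordinate difference is one term of the sum under the root. The inclusion gives
    access to sup-norm balls, which generate the neighbourhoods and whose volume is a product. *)
Lemma eball_sub_ball (R : realType) (N : nat) (x : 'rV[R]_N) (r : R) :
  0 < r -> eball x r `<=` ball x r.
Proof.
move=> r0 y; rewrite /eball /= => yr; split => // i j; rewrite ord1.
rewrite /ball/= distrC -sqrtr_sqr; apply: le_lt_trans yr; apply: ler_wsqrtr.
rewrite (bigD1 j)//= lerDl; apply: sumr_ge0 => k _; exact: sqr_ge0.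
Qed.

Lemma lebesgue_rV_ball (R : realType) (N : nat) (x : 'rV[R]_N) (r : R) :
  0 < r -> lebesgue_rV (ball x r) = ((r *+ 2) ^+ N)%:E.
Proof.
move=> r0.
rewrite (_ : ball x r = [set y | forall i, ball (x ord0 i) r (y ord0 i)]).
  rewrite (@lebesgue_rV_prod _ _ (fun i => ball (x ord0 i) r)) => [|i];
    last exact: measurable_ball.
  under eq_bigr do rewrite lebesgue_measure_ball ?ltW//.
  by rewrite prodEFin prodr_const card_ord.
apply/seteqP; split => y /=; first by move=> [_ +] i; exact.
by move=> xy; split => // i j; rewrite ord1; exact: xy.
Qed.

(** Comparison with the enclosing cube replaces the exact Euclidean volume. Finiteness matters
    because [fine] sends +oo to 0 and because measures of balls get subtracted. *)
Lemma lebesgue_rV_eball_lty (R : realType) (N : nat) (x : 'rV[R]_N) (r : R) :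
  0 < r -> (lebesgue_rV (eball x r) < +oo)%E.
Proof.
move=> r0; apply: (@le_lt_trans _ _ (lebesgue_rV (ball x r))).
  apply: le_measure; last exact: eball_sub_ball.
  - by rewrite inE; apply: open_measurable_rV; exact: eball_open.
  - by rewrite inE; apply: open_measurable_rV; exact: ball_open.
by rewrite lebesgue_rV_ball// ltry.
Qed.

(** Openness puts a small cube around [x] inside the Euclidean ball. *)
Lemma lebesgue_rV_eball_gt0 (R : realType) (N : nat) (x : 'rV[R]_N) (r : R) :
  0 < r -> (0 < lebesgue_rV (eball x r))%E.
Proof.
move=> r0.
have /nbhs_ballP[e /= e0 er] : nbhs x (eball x r).
  by apply: open_nbhs_nbhs; split; [exact: eball_open|exact: eball_center].
apply: (@lt_le_trans _ _ (lebesgue_rV (ball x e))).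
  by rewrite lebesgue_rV_ball// lte_fin exprn_gt0// mulrn_wgt0.
apply: le_measure => //.
- by rewrite inE; apply: open_measurable_rV; exact: ball_open.
- by rewrite inE; apply: open_measurable_rV; exact: eball_open.
Qed.

Lemma near_eball_sub (R : realType) (N : nat) (U : set 'rV[R]_N) (y : 'rV[R]_N) :
  open U -> U y -> \forall r \near (0 : R)^'+, 0 < r /\ eball y r `<=` U.
Proof.
move=> oU Uy.
have /nbhs_ballP[e /= e0 eU] : nbhs y U by exact: open_nbhs_nbhs.
near=> r; have r0 : 0 < r by near: r; exact: nbhs_right_gt.
split => // z /(eball_sub_ball r0) yz; apply: eU; apply: le_ball yz.
by near: r; exact: nbhs_right_le.
Unshelve. all: by end_near. Qed.

Lemma density_one_null (R : realType) (N : nat) (F U : set 'rV[R]_N)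
    (y : 'rV[R]_N) : measurable F -> open U ->
  lebesgue_rV (F `&` U) = 0%E -> U y ->
  ~ density_one F y /\ density_one (~` F) y.
Proof.
move=> mF oU FU0 Uy.
have mb r : measurable (eball y r) by apply: open_measurable_rV; exact: eball_open.
have null r : eball y r `<=` U -> lebesgue_rV (F `&` eball y r) = 0%E.
  move=> rU; apply/eqP; rewrite -measure_le0 -FU0; apply: le_measure.
  - by rewrite inE; exact: measurableI.
  - by rewrite inE; apply: measurableI => //; exact: open_measurable_rV.
  - exact: setIS.
split; rewrite /density_one /=; last first.
  apply: cvg_near_cst; near=> r.
  have [r0 rU] : 0 < r /\ eball y r `<=` U by near: r; exact: near_eball_sub.
  have -> : lebesgue_rV (~` F `&` eball y r) = lebesgue_rV (eball y r).
    rewrite [RHS](measureDI _ (mb r) mF) setIC setDE.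
    by rewrite [X in (_ + lebesgue_rV X)%E]setIC null// adde0.
  (* The denominator is nonzero because the volume of the ball is both positive and finite. *)
  rewrite divff// gt_eqF// fine_gt0//.
  by rewrite lebesgue_rV_eball_gt0// lebesgue_rV_eball_lty.
move=> F1; have F0 : fine (lebesgue_rV (F `&` eball y r)) /
    fine (lebesgue_rV (eball y r)) @[r --> 0^'+] --> (0 : R).
  apply: cvg_near_cst; near=> r.
  have [r0 rU] : 0 < r /\ eball y r `<=` U by near: r; exact: near_eball_sub.
  by rewrite null// mul0r.
have /eqP : (1 : R) = 0 by exact: cvg_unique F1 F0.
by rewrite oner_eq0.
Unshelve. all: by end_near. Qed.

Lemma lambda_representative0 (R : realType) (N : nat)
    (lambda : 'rV[R]_N -> R) (E U : set 'rV[R]_N) (y : 'rV[R]_N) :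
  measurable E -> open U -> lebesgue_rV (E `&` U) = 0%E -> U y ->
  lambda_representative lambda E y = 0.
Proof.
move=> mE oU EU0 Uy; have [nE1 Ec1] := density_one_null mE oU EU0 Uy.
rewrite /lambda_representative !indicE !memNset ?mulr0 ?addr0//.
by apply; right.
Qed.

Lemma lambda_representative1 (R : realType) (N : nat)
    (lambda : 'rV[R]_N -> R) (E U : set 'rV[R]_N) (y : 'rV[R]_N) :
  measurable E -> open U -> lebesgue_rV (~` E `&` U) = 0%E -> U y ->
  lambda_representative lambda E y = 1.
Proof.
move=> mE oU EU0 Uy.
have [_ ] := density_one_null (measurableC mE) oU EU0 Uy.
rewrite setCK => E1.
rewrite /lambda_representative !indicE mem_set// memNset ?mulr0 ?addr0//.
by apply; left.
Qed.

Lemma charge_integral0 d (T : measurableType d) (R : realType)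
    (nu : {charge set T -> \bar R}) : charge_integral nu (fun=> 0) = 0.
Proof. by rewrite /charge_integral !Rintegral_cst// !mul0r subr0. Qed.

(** The complement of the closed support is open, so [f] vanishes on a whole neighbourhood of [x];
    this is what kills the partial derivatives. *)
Lemma notin_tsupport (R : realType) (N : nat) (f : 'rV[R]_N -> R)
    (x : 'rV[R]_N) : ~ tsupport f x -> f x = 0 /\ forall i, partial i f x = 0.
Proof.
move=> fx.
have f0 y : ~ tsupport f y -> f y = 0.
  by move=> fy; apply: contra_notP fy => /eqP fy; exact: subset_closure.
split => [|i]; first exact: f0.
(* Reading 0 as the derivative of the constant 0 reduces the goal to equality of two functions near
   [x]. *)
rewrite /partial -[RHS](@derive_cst _ _ _ (0 : R) x (delta_mx ord0 i)).
apply: near_eq_derive.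
have : nbhs x (~` tsupport f).
  by apply: open_nbhs_nbhs; split => //; apply: closed_openC; exact: closed_closure.
by apply: filterS => y; exact: f0.
Qed.

(** The integrands agree at every point: off the support the factor [phi x] is 0. *)
Lemma weighted_integral_eq (R : realType) (N : nat) (Omega : set 'rV[R]_N)
    (mu : radon Omega) (g h : 'rV[R]_N -> R) (phi : test_function Omega) :
  {in tsupport phi, g =1 h} ->
  weighted_integral mu g phi = weighted_integral mu h phi.
Proof.
move=> gh; rewrite /weighted_integral; congr (radon_integral _ _ _).
apply/funext => x; have [xs|xs] := pselect (tsupport phi x).
  by rewrite gh// inE.
by have [-> _] := notin_tsupport xs; rewrite !mulr0.
Qed.

Lemma weighted_flux_eq (R : realType) (N : nat) (Omega : set 'rV[R]_N)
    (A : vector_radon Omega) (g h : 'rV[R]_N -> R) (phi : test_function Omega) :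
  {in tsupport phi, g =1 h} ->
  weighted_flux A g phi = weighted_flux A h phi.
Proof.
move=> gh; apply: eq_bigr => i _; congr (radon_integral _ _ _).
apply/funext => x; have [xs|xs] := pselect (tsupport phi x).
  by rewrite gh// inE.
by have [_ ->] := notin_tsupport xs; rewrite !mulr0.
Qed.

Lemma weighted_integral0 (R : realType) (N : nat) (Omega : set 'rV[R]_N)
    (mu : radon Omega) (phi : test_function Omega) :
  weighted_integral mu (fun=> 0) phi = 0.
Proof.
rewrite /weighted_integral /radon_integral.
by under eq_fun do rewrite mul0r; exact: charge_integral0.
Qed.

Lemma weighted_flux0 (R : realType) (N : nat) (Omega : set 'rV[R]_N)
    (A : vector_radon Omega) (phi : test_function Omega) :
  weighted_flux A (fun=> 0) phi = 0.
Proof.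
apply: big1 => i _; rewrite /radon_integral.
by under eq_fun do rewrite mul0r; exact: charge_integral0.
Qed.

(** At a radius where the double inequality fails, either [E] is null in the ball or it fills the
    ball in measure; in the second case subtraction, legitimate for a ball of finite measure, makes
    the complement null. *)
Lemma not_boundary_minus (R : realType) (N : nat) (E : set 'rV[R]_N)
    (x : 'rV[R]_N) : measurable E -> ~ boundary_minus E x ->
  exists2 r : R, 0 < r & lebesgue_rV (E `&` eball x r) = 0%E \/
    lebesgue_rV (~` E `&` eball x r) = 0%E.
Proof.
move=> mE /existsNP[r /not_implyP[r0 /negP]]; rewrite negb_and -!leNgt => H.
exists r => //; case/orP: H => [|le_E]; first by rewrite measure_le0 => /eqP; left.
have mb : measurable (eball x r) by apply: open_measurable_rV; exact: eball_open.
have EbI : lebesgue_rV (E `&` eball x r) = lebesgue_rV (eball x r).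
  apply/eqP; rewrite eq_le le_E andbT; apply: le_measure => //.
  - by rewrite inE; exact: measurableI.
  - by rewrite inE.
right; rewrite setIC -setDE measureD//; last exact: lebesgue_rV_eball_lty.
rewrite [X in (_ - lebesgue_rV X)%E]setIC EbI subee//.
by rewrite ge0_fin_numE// lebesgue_rV_eball_lty.
Qed.

Theorem proposition7p2 (R : realType) (N : nat) (N_gt0 : (0 < N)%N)
  (Omega : set 'rV[R]_N) (Omega_open : open Omega) (Omega_neq0 : Omega !=set0)
  (A : DMloc Omega)
  (lambda : 'rV[R]_N -> R) (lambda_borel : measurable_fun Omega lambda)
  (lambda01 : forall x, Omega x -> 0 <= lambda x <= 1)
  (E : set 'rV[R]_N) (E_borel : measurable E) (E_sub : E `<=` Omega) :
  dist_support (lambda_pairing A lambda E) `<=` boundary_minus E.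
Proof.
move=> x [Ox xsupp].
apply: contra_notP xsupp => /(not_boundary_minus E_borel)[r r0 null].
have oB : open (eball x r) by exact: eball_open.
(* The ball may leave [Omega], whereas [dist_support] only removes open subsets of [Omega]. *)
exists (eball x r `&` Omega); last by split => //; exact: eball_center.
split; [exact: openI|exact: subIsetr|move=> phi [_ phiU]].
have phi_eball y : y \in tsupport phi -> eball x r y by rewrite inE => /phiU[].
rewrite /lambda_pairing; case: null => null.
- have rep0 : {in tsupport phi, lambda_representative lambda E =1 fun=> 0}.
    by move=> y /phi_eball; exact: lambda_representative0.
  rewrite (weighted_integral_eq _ rep0).
  rewrite (weighted_flux_eq _ rep0).
  by rewrite weighted_integral0 weighted_flux0 oppr0 addr0.
- have rep1 : {in tsupport phi, lambda_representative lambda E =1 fun=> 1}.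
    by move=> y /phi_eball; exact: lambda_representative1.
  rewrite (weighted_integral_eq _ rep1).
  rewrite (weighted_flux_eq _ rep1).
  (* With weight 1, [DM_divP] turns minus the divergence term into the flux, which cancels the flux
     subtracted in the pairing. *)
  by rewrite DM_divP opprK subrr.
Qed.
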